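(* Let $L$ be a finite-dimensional monolithic solvable Leibniz $A$-algebra of derived length $n+1$ over a field $F$, with monolith $W$ and nilradical $N$. Let $L=A_n\dot{+}A_{n-1}\dot{+}\cdots\dot{+}A_0$, where $A_i$ is an abelian subalgebra of $L$ and $L^{(i)}=A_n\dot{+}A_{n-1}\dot{+}\cdots\dot{+}A_i$ for each $0\le i\le n$. Then (i) $W$ is abelian; (ii) $Z(L)=0$ and either $[L,W]=W$ or $[W,L]=W$; (iii) $N=A_n=L^{(n)}$; (iv) $N=Z_L(W)$; and (v) $L$ is $\phi$-free if and only if $W=N$.
   Context: A (right) Leibniz algebra over $F$ is a vector space with a bilinear product $[\,,]$ satisfying $[x,[y,z]]=[[x,y],z]-[[x,z],y]$ for all $x,y,z$. Ideals are two-sided. Lower central series: $L^1=L$, $L^{k+1}=[L^k,L]$; $L$ is nilpotent if $L^k=0$ for some $k$. Derived series: $L^{(0)}=L$, $L^{(k+1)}=[L^{(k)},L^{(k)}]$; $L$ is solvable of derived length $m$ if $L^{(m)}=0$ but $L^{(m-1)}\ne 0$. $L$ is abelian if $[x,y]=0$ for all $x,y$. $L$ is an $A$-algebra if every nilpotent subalgebra of $L$ is abelian. The nilradical is the largest nilpotent ideal of $L$. $L$ is monolithic with monolith $W$ if $W$ is the unique minimal ideal of $L$. The centre is $Z(L)=\{z\in L : [z,x]=[x,z]=0 \text{ for all } x\in L\}$ and the centraliser of $W$ is $Z_L(W)=\{x\in L : [x,W]=[W,x]=0\}$. The Frattini ideal $\phi(L)$ is the largest ideal of $L$ contained in all maximal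 subalgebras of $L$; $L$ is $\phi$-free if $\phi(L)=0$. $\dot{+}$ denotes a vector space direct sum.
   Formalization: Part (ii) is stated only for n ≥ 1: when n = 0, L is the one-dimensional abelian algebra with W = N = L, so Z(L) = L ≠ 0 and [L,W] = [W,L] = 0, and (ii) fails; the other parts are stated for all n. *)

(* Defs.v *)
From HB Require Import structures.
From mathcomp Require Import all_boot all_order all_algebra.

Set Implicit Arguments.
Unset Strict Implicit.
Unset Printing Implicit Defensive.

Import GRing.Theory.
Local Open Scope ring_scope.

Section Leibniz.

Variables (F : fieldType) (L : vectType F) (br : {bilinear L -> L -> L}).
Implicit Types U V W I M N P : {vspace L}.

(* Right Leibniz identity: right multiplications are derivations. *)
Definition right_leibniz : Prop :=
  forall x y z : L, br x (br y z) = br (br x y) z - br (br x z) y.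

(* [U, V] is the span of all products br u v; by bilinearity it is enough to
   take u and v in bases, see brvP. *)
Definition brv U V : {vspace L} :=
  <<[seq br u v | u <- vbasis U, v <- vbasis V]>>%VS.

Lemma brvP {U V W} :
  reflect {in U & V, forall u v, br u v \in W} (brv U V <= W)%VS.
Proof.
apply: (iffP idP) => [sUVW u v Uu Vv | UVW].
  apply: (subvP sUVW); rewrite (coord_vbasis Uu) (coord_vbasis Vv).
  rewrite linear_sumlz; apply: memv_suml => i _.
  rewrite linear_sumr; apply: memv_suml => j _.
  rewrite linearZl_LR linearZr_LR; do 2!apply: memvZ.
  by apply: memv_span; apply: allpairs_f; apply: mem_nth; rewrite size_tuple.
apply/span_subvP => _ /allpairsP[[u v] /= [Uu Vv ->]].
by apply: UVW; apply: vbasis_mem.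
Qed.

Definition subalgebra U : Prop := (brv U U <= U)%VS.

Definition ideal I : Prop := (brv I fullv <= I)%VS /\ (brv fullv I <= I)%VS.

Definition abelian U : Prop := {in U &, forall x y, br x y = 0}.

(* The index is shifted: lower_central U k is U^(k+1). *)
Definition lower_central U (k : nat) : {vspace L} :=
  iter k (fun V => brv V U) U.

Definition nilpotent U : Prop := exists k, lower_central U k = 0%VS.

Definition derived U (k : nat) : {vspace L} := iter k (fun V => brv V V) U.

Definition solvable_of_derived_length (m : nat) : Prop :=
  derived fullv m = 0%VS /\ derived fullv m.-1 <> 0%VS.

Definition A_algebra : Prop :=
  forall U, subalgebra U -> nilpotent U -> abelian U.

Definition is_nilradical N : Prop :=
  [/\ ideal N, nilpotent N &
      forall I, ideal I -> nilpotent I -> (I <= N)%VS].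

Definition minimal_ideal W : Prop :=
  [/\ ideal W, W <> 0%VS &
      forall I, ideal I -> (I <= W)%VS -> I = 0%VS \/ I = W].

Definition monolithic_with W : Prop :=
  minimal_ideal W /\ forall V, minimal_ideal V -> V = W.

Definition maximal_subalgebra M : Prop :=
  [/\ subalgebra M, M <> fullv &
      forall U, subalgebra U -> (M <= U)%VS -> U = M \/ U = fullv].

Definition in_all_maximal_subalgebras I : Prop :=
  forall M, maximal_subalgebra M -> (I <= M)%VS.

Definition is_frattini_ideal P : Prop :=
  [/\ ideal P, in_all_maximal_subalgebras P &
      forall I, ideal I -> in_all_maximal_subalgebras I -> (I <= P)%VS].

Definition phi_free : Prop := is_frattini_ideal 0%VS.

Definition centre (z : L) : Prop := forall x, br z x = 0 /\ br x z = 0.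

Definition centraliser W (x : L) : Prop :=
  forall w, w \in W -> br x w = 0 /\ br w x = 0.

End Leibniz.

(* Main.v *)
Require Import Defs.
From HB Require Import structures.
From mathcomp Require Import all_boot all_order all_algebra.
From Stdlib Require Import Classical.
Import GRing.Theory.
Local Open Scope ring_scope.

(** Let [K] be the last nonzero term of the derived series and, when it is not
    all of [L], let [M] be the term before it.  In an A-algebra, right
    multiplication by [x] on an abelian subspace [V], stable under both
    multiplications by [x] with [[x, x] = 0], has Fitting null component equal
    to its kernel, because this component together with [x] spans a nilpotent,
    hence abelian, subalgebra.  A metabelian subalgebra [E] with [D = [E, E]] is
    [D + B] with [B] abelian (shrink [E] by Fitting null components), and the
    joint Fitting decomposition of [D] under [B] then shows that no nonzero
    element of [D] centralises [E].

    Every nonzero ideal contains [W].  So if [C(W)] were not abelian, [W] would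
    lie in the last nonzero term of the derived series of [C(W)] and centralise
    the term before it; hence [C(W)] is an abelian ideal and equals [N].  Likewise
    [C(M) = 0]: writing [M = K + B], the centraliser of [B] in [N] lies in [C(M)],
    so [N = [N, B]], which is contained in [M] and then in [[M, M] = K].  For the
    Frattini statement, [K] is supplemented by the Fitting null component of some
    [b] in [B]; conversely a maximal subalgebra [P] missing [W] meets [K] in an
    ideal not containing [W], so [K = W + (K ∩ P) = W]. *)

(** * Fitting null components of an endomorphism *)

Section FittingNull.

Context {F : fieldType} {L : vectType F} (f : 'End(L)).
Implicit Types (U : {vspace L}) (u v : L).

(** This is the kernel of the [k]-th power of [f]; iterating preimages lets membership unfold one
    application of [f] at a time. *)
Definition gnull (k : nat) : {vspace L} := iter k (fun V => f @^-1: V)%VS 0%VS.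

Lemma memv_gnull0 u : (u \in gnull 0) = (u == 0).
Proof. exact: memv0. Qed.

Lemma memv_gnullS k u : (u \in gnull k.+1) = (f u \in gnull k).
Proof. by rewrite /gnull iterS memv_preim. Qed.

Lemma gnullS k : (gnull k <= gnull k.+1)%VS.
Proof.
elim: k => [|k IHk]; first exact: sub0v.
by apply/subvP => u; rewrite (memv_gnullS k) (memv_gnullS k.+1); apply: (subvP IHk).
Qed.

Lemma gnull_le i j : (i <= j)%N -> (gnull i <= gnull j)%VS.
Proof.
by move/subnK <-; elim: (j - i)%N => // k /subv_trans; apply; apply: gnullS.
Qed.

Lemma gnull_stable : exists k, forall j, (gnull j <= gnull k)%VS.
Proof.
suff: forall m k, (\dim {:L} - \dim (gnull k) < m)%N ->
    exists k, forall j, (gnull j <= gnull k)%VS.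
  by move/(_ _ 0%N (ltnSn _)).
elim=> // m IHm k lt_m.
case: (classic (forall j, (gnull j <= gnull k)%VS)) => [|nstab]; first by exists k.
have [j /negP ltkj] := not_all_ex_not _ _ nstab.
apply: (IHm j); have le_kj: (k <= j)%N.
  by apply: contraNT ltkj; rewrite -ltnNge => /ltnW /gnull_le.
have lt_dim : (\dim (gnull k) < \dim (gnull j))%N.
  rewrite ltn_neqAle (dimvS (gnull_le _ _ le_kj)) andbT.
  by apply: contraNneq ltkj => eqd; have /eqP <- : gnull k == gnull j
    by rewrite eqEdim gnull_le //= eqd.
have le_dim : (\dim (gnull j) <= \dim {:L})%N by apply/dimvS/subvf.
by rewrite -ltnS (leq_trans _ lt_m) // ltnS ltn_sub2l // (leq_trans lt_dim).
Qed.

(** If [f] does not map [U] onto itself, induct on the image: a decomposition of [f u] there pulls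
    back to one of [u], with the null index raised by one. *)
Lemma fitting_ex U : (f @: U <= U)%VS ->
  exists k, forall u, u \in U -> exists2 v, v \in U & u - f (f v) \in gnull k.
Proof.
move: {2}(\dim U).+1 (ltnSn (\dim U)) => m; elim: m U => // m IHm U lt_m sfU.
have [eqfU | nefU] := eqVneq (f @: U)%VS U.
  exists 0%N => u; rewrite -{1}eqfU => /memv_imgP[v Uv ->].
  move: Uv; rewrite -{1}eqfU => /memv_imgP[w Uw ->].
  by exists w; rewrite ?subrr ?mem0v.
have lt_dim: (\dim (f @: U) < \dim U)%N.
  by rewrite ltn_neqAle dimvS // andbT; apply: contraNneq nefU => eqd;
     rewrite eqEdim sfU eqd leqnn.
have [||k IHk] := IHm (f @: U)%VS; first exact: leq_trans lt_dim _.
  exact: limgS.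
exists k.+1 => u Uu; have [v /memv_imgP[w Uw ->]] := IHk _ (memv_img f Uu).
by exists w => //; rewrite memv_gnullS linearB.
Qed.

Lemma fitting_null U : (f @: U <= U)%VS ->
  exists k, (forall j, (gnull j <= gnull k)%VS) /\
    forall u, u \in U -> exists2 v, v \in U & u - f (f v) \in gnull k.
Proof.
move=> sfU; have [k stab] := gnull_stable; have [j fit] := fitting_ex U sfU.
exists k; split=> // u /fit[v Uv unull]; exists v => //.
exact: (subvP (stab j)).
Qed.

End FittingNull.

(** * Products, ideals and centralisers in a Leibniz algebra *)

Section LeibnizAlgebra.

Context {F : fieldType} {L : vectType F} {br : {bilinear L -> L -> L}}.
Hypothesis leibniz : right_leibniz br.
Implicit Types (B D I J U V X : {vspace L}) (u v w x y z : L).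

Definition Rmul x : 'End(L) := linfun (applyr br x).
Definition Lmul x : 'End(L) := linfun (br x).

Lemma RmulE x y : Rmul x y = br y x. Proof. by rewrite lfunE. Qed.
Lemma LmulE x y : Lmul x y = br x y. Proof. by rewrite lfunE. Qed.

Lemma br_derivation u v x : br (br u v) x = br (br u x) v + br u (br v x).
Proof. by rewrite leibniz addrC subrK. Qed.

Lemma br_anti x y z : br x (br y z) = - br x (br z y).
Proof. by rewrite !leibniz opprB. Qed.

(** Right multiplication by [x] is a derivation, so each term it produces from a product lowers the
    index of one of the two factors. *)
Lemma gnull_br x i j u v : u \in gnull (Rmul x) i -> v \in gnull (Rmul x) j ->
  br u v \in gnull (Rmul x) (i + j).
Proof.
elim: i j u v => [|i IHi] j u v.
  by rewrite memv_gnull0 => /eqP-> _; rewrite linear0l mem0v.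
elim: j v => [|j IHj] v nu.
  by rewrite memv_gnull0 => /eqP->; rewrite linear0r mem0v.
move=> nv; rewrite addSn memv_gnullS RmulE br_derivation memvD //.
  by apply: IHi => //; rewrite -RmulE -memv_gnullS.
by rewrite -addSnnS IHj // -RmulE -memv_gnullS.
Qed.

Lemma memv_br U V u v : u \in U -> v \in V -> br u v \in brv br U V.
Proof. by move: u v; apply/brvP. Qed.

Lemma brvS U U' V V' : (U <= U')%VS -> (V <= V')%VS ->
  (brv br U V <= brv br U' V')%VS.
Proof.
move=> /subvP sU /subvP sV; apply/brvP => u v Uu Vv.
by rewrite memv_br ?sU ?sV.
Qed.

Lemma subalgebraP U :
  subalgebra br U <-> {in U &, forall u v, br u v \in U}.
Proof. by split=> [/brvP|h]; last apply/brvP. Qed.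

Lemma idealP I :
  ideal br I <-> forall u x, u \in I -> br u x \in I /\ br x u \in I.
Proof.
split=> [[/brvP Il /brvP Ir] u x Iu | hI].
  by split; [apply: Il | apply: Ir]; rewrite ?memvf.
by split; apply/brvP => u v Iu Iv; [case: (hI u v) | case: (hI v u)].
Qed.

(** Left multiplication by $x$ sends $[u,v]$ to $[[x,u],v]-[[x,v],u]$; the last term lies in
    $[J,I]$, which the third hypothesis places in $[I,J]$. *)
Lemma ideal_brv I J : ideal br I -> ideal br J -> (brv br J I <= brv br I J)%VS ->
  ideal br (brv br I J).
Proof.
move=> /idealP hI /idealP hJ sJI; split; apply/brvP => x y; last first.
  move=> _; rewrite -LmulE memv_preim; move: y; apply/subvP/brvP => u v Iu Jv.
  rewrite -memv_preim LmulE leibniz memvB //.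
    by rewrite memv_br //; case: (hI u x).
  by apply: (subvP sJI); rewrite memv_br //; case: (hJ v x).
rewrite -RmulE memv_preim => + _; move: x; apply/subvP/brvP => u v Iu Jv.
by rewrite -memv_preim RmulE br_derivation memvD ?memv_br //;
  [case: (hI u y) | case: (hJ v y)].
Qed.

Lemma derivedS U k : derived br U k.+1 = brv br (derived br U k) (derived br U k).
Proof. by []. Qed.

Lemma ideal_derived I k : ideal br I -> ideal br (derived br I k).
Proof. by move=> hI; elim: k => // k IHk; apply: ideal_brv. Qed.

Lemma idealT : ideal br fullv.
Proof. by split; apply: subvf. Qed.

Lemma ideal0 : ideal br 0%VS.
Proof.
apply/idealP => u x; rewrite !memv0 => /eqP->.
by rewrite linear0l linear0r eqxx.
Qed.

Lemma ideal_subalgebra I : ideal br I -> subalgebra br I.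
Proof. by move=> /idealP hI; apply/subalgebraP => u v Iu _; case: (hI u v). Qed.

Lemma abelian_brv0 U : abelian br U <-> brv br U U = 0%VS.
Proof.
split=> [cU | U0 u v Uu Uv].
  by apply/eqP; rewrite -subv0; apply/brvP => u v Uu Uv; rewrite cU ?mem0v.
by apply/eqP; rewrite -memv0 -U0 memv_br.
Qed.

Lemma abelian_nilpotent U : abelian br U -> nilpotent br U.
Proof. by move=> /abelian_brv0 cU; exists 1%N. Qed.

Lemma abelianS U V : (U <= V)%VS -> abelian br V -> abelian br U.
Proof. by move=> /subvP sUV cV u v /sUV Vu /sUV; apply: cV. Qed.

(** Intersecting over a basis turns the predicate [centraliser] into a subspace, so that ideal
    arguments apply to it. *)
Definition centv U : {vspace L} :=
  (\bigcap_(u <- vbasis U) (lker (Rmul u) :&: lker (Lmul u)))%VS.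

Lemma centvP U x : x \in centv U <-> centraliser br U x.
Proof.
have bigcapP (s : seq L) : (x \in \bigcap_(u <- s) (lker (Rmul u) :&: lker (Lmul u)))%VS
    = all (fun u => (br x u == 0) && (br u x == 0)) s.
  elim: s => [|u s IHs]; first by rewrite big_nil memvf.
  by rewrite big_cons memv_cap IHs memv_cap !memv_ker !lfunE.
rewrite /centv bigcapP; split=> [/allP cx u Uu | cx].
  have: u \in (lker (Lmul x) :&: lker (Rmul x))%VS.
    move: u Uu; rewrite -{1}(span_basis (vbasisP U)); apply/subvP/span_subvP.
    by move=> u /cx; rewrite memv_cap !memv_ker !lfunE.
  by rewrite memv_cap !memv_ker LmulE RmulE => /andP[/eqP-> /eqP->].
by apply/allP => u /vbasis_mem/cx[-> ->]; rewrite eqxx.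
Qed.

Lemma ideal_centv I : ideal br I -> ideal br (centv I).
Proof.
move=> /idealP hI; apply/idealP => z x /centvP cz.
have cz0 y : y \in I -> br z y = 0 by case/cz.
have zc0 y : y \in I -> br y z = 0 by case/cz.
split; apply/centvP => w Iw; have [Iwx Ixw] := hI w x Iw; split.
- by rewrite br_derivation cz0 // linear0l add0r cz0.
- by rewrite leibniz zc0 // linear0l zc0 ?subr0.
- by rewrite br_derivation zc0 // cz0 // linear0r addr0.
- by rewrite br_anti leibniz zc0 // linear0l zc0 // subr0 oppr0.
Qed.

(** * Fitting null components in an A-algebra *)

Hypothesis A_alg : A_algebra br.

(** $[U,U]$ lies in [D], and since [D] is abelian, elements of [U] act on [D] from the right as
    multiples of [x]. Each further term of the lower central series thus drops one null index, so
    [U] is nilpotent. *)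
Lemma abelian_extend {D x k} : abelian br D -> br x x \in D ->
  (forall d, d \in D -> br d x \in D /\ br x d \in D) ->
  (D <= gnull (Rmul x) k)%VS -> abelian br (D + <[x]>)%VS.
Proof.
move=> cD Dxx Dx Dnil; set U := (D + <[x]>)%VS.
have sUD : (brv br U U <= D)%VS.
  apply/brvP => _ _ /memv_addP[d Dd [_ /vlineP[a ->] ->]]
                   /memv_addP[e De [_ /vlineP[b ->] ->]].
  rewrite linearDl !linearDr /= !linearZl_LR !linearZr_LR /= (cD _ _ Dd De) add0r.
  by rewrite !memvD ?memvZ //; [case: (Dx d) | case: (Dx e)].
apply: A_alg; first exact: subv_trans sUD (addvSl _ _).
exists k.+1; apply/eqP; rewrite -subv0.
suff lc j : (lower_central br U j.+1 <= D :&: gnull (Rmul x) (k - j))%VS.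
  by apply: subv_trans (lc k) _; rewrite subnn capvSr.
elim: j => [|j IHj]; first by rewrite subv_cap sUD subn0 (subv_trans sUD).
apply/brvP => z u /(subvP IHj); rewrite memv_cap => /andP[Dz nz].
move=> /memv_addP[d Dd [_ /vlineP[a ->] ->]].
rewrite linearDr /= linearZr_LR /= cD // add0r memvZ // memv_cap.
have [-> _] := Dx z Dz; rewrite -RmulE -memv_gnullS.
by rewrite (subvP (gnull_le (Rmul x) (k - j) _ _)) // subnS leqSpred.
Qed.

Lemma gnull_sub_ker {V b k v} : abelian br V -> br b b = 0 ->
  (forall v, v \in V -> br v b \in V /\ br b v \in V) ->
  v \in V -> v \in gnull (Rmul b) k -> br v b = 0 /\ br b v = 0.
Proof.
move=> cV bb0 Vb Vv nv; pose D := (V :&: gnull (Rmul b) k)%VS.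
have Dv: v \in D by rewrite memv_cap Vv.
(* As $[b,b]=0$, left and right multiplication by [b] commute, so left multiplication preserves
   every null component. *)
have comm w : br (br b w) b = br b (br w b).
  by rewrite leibniz bb0 linear0l subr0.
have nL j w : w \in gnull (Rmul b) j -> br b w \in gnull (Rmul b) j.
  elim: j w => [|j IHj] w; first by rewrite !memv_gnull0 => /eqP->; rewrite linear0r.
  by rewrite !memv_gnullS !RmulE comm; apply: IHj.
have cDb: abelian br (D + <[b]>)%VS.
  apply: (@abelian_extend D b k); rewrite ?bb0 ?mem0v ?capvSr //.
    exact: abelianS (capvSl _ _) cV.
  move=> d; rewrite memv_cap => /andP[Vd nd]; have [Vdb Vbd] := Vb d Vd.
  rewrite !memv_cap Vdb Vbd nL //=; split=> //.
  by rewrite -RmulE -memv_gnullS (subvP (gnullS _ _)).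
have Db: b \in (D + <[b]>)%VS by rewrite (subvP (addvSr _ _)) ?memv_line.
have {}Dv: v \in (D + <[b]>)%VS by rewrite (subvP (addvSl _ _)).
by rewrite !cDb.
Qed.


(** * Splitting of metabelian subalgebras *)

Lemma Rmul_stable U b : subalgebra br U -> b \in U -> (Rmul b @: U <= U)%VS.
Proof.
move=> /subalgebraP hU Ub; apply/subvP => _ /memv_imgP[u Uu ->].
by rewrite RmulE hU.
Qed.

(** A product of two elements of index [k] has index [k + k], which stability brings back to [k]. *)
Lemma fitting_null_subalgebra U x k :
  subalgebra br U -> (forall j, (gnull (Rmul x) j <= gnull (Rmul x) k)%VS) ->
  subalgebra br (U :&: gnull (Rmul x) k)%VS.
Proof.
move=> /subalgebraP hU stab; apply/subalgebraP => u v.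
rewrite !memv_cap => /andP[Uu nu] /andP[Uv nv].
by rewrite hU // (subvP (stab (k + k)%N)) // gnull_br.
Qed.

(** [D] stays fixed while [U] shrinks to Fitting null components; what is lost lies in $[U,U]$,
    hence in [D]. Once every right multiplication by an element of [U] is nilpotent on [U], [U]
    itself is nilpotent and serves as [B]. *)
Lemma abelian_supplement D U : abelian br D -> subalgebra br U ->
  (brv br U U <= D)%VS ->
  exists B, [/\ (B <= U)%VS, abelian br B & (U <= D + B)%VS].
Proof.
move=> cD; move: {2}(\dim U).+1 (ltnSn (\dim U)) => m.
elim: m U => // m IHm U lt_m hU sUD; have /subalgebraP mU := hU.
case: (classic (forall b, b \in U -> exists k, (U <= gnull (Rmul b) k)%VS))
  => [Unil | /not_all_ex_not[b nb]].
  exists U; split; rewrite ?addvSr ?subvv //; apply: A_alg => //.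
  (* Adjoining [b] to [U :&: D] gives an abelian subspace; this will yield $[[U,U],U]=0$. *)
  have cDU b d : b \in U -> d \in (U :&: D)%VS -> br d b = 0.
    move=> Ub Dd; have [k nk] := Unil b Ub.
    have cDb : abelian br ((U :&: D)%VS + <[b]>)%VS.
      apply: (@abelian_extend _ _ k); first exact: abelianS (capvSr _ _) cD.
      - by rewrite memv_cap mU // (subvP sUD) // memv_br.
      - move=> e; rewrite !memv_cap => /andP[Ue _].
        by rewrite !mU // !(subvP sUD) ?memv_br.
      - exact: subv_trans (capvSl _ _) nk.
    apply: cDb; first exact: (subvP (addvSl _ _)).
    by apply: (subvP (addvSr _ _)); apply: memv_line.
  exists 2%N; apply/eqP; rewrite -subv0; apply/brvP => d b Dd Ub.
  rewrite cDU ?mem0v // memv_cap; apply/andP; split; last exact: (subvP sUD).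
  exact: (subvP hU).
have [Ub nnil] : b \in U /\ forall k, ~ (U <= gnull (Rmul b) k)%VS.
  by have [Ub nk] := imply_to_and _ _ nb; split=> // k ?; apply: nk; exists k.
have [k [stab fit]] := fitting_null _ _ (Rmul_stable U b hU Ub).
set U0 := (U :&: gnull (Rmul b) k)%VS.
have sU0 : (U0 <= U)%VS by apply: capvSl.
have [|||B [sB cB sU0B]] := IHm U0.
- apply: leq_trans (_ : (\dim U0).+1 <= \dim U)%N lt_m.
  rewrite ltn_neqAle dimvS // andbT; apply/eqP => eqd; case: (nnil k).
  have /eqP <- : U0 == U by rewrite eqEdim sU0 eqd /=.
  exact: capvSr.
- exact: fitting_null_subalgebra.
- exact: subv_trans (brvS _ _ _ _ sU0 sU0) sUD.
exists B; split=> //; first exact: subv_trans sB sU0.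
apply/subvP => u Uu; have [v Uv nuv] := fit u Uu; rewrite -(subrK (Rmul b (Rmul b v)) u).
have UD : Rmul b (Rmul b v) \in brv br U U by rewrite !RmulE memv_br ?mU.
rewrite memvD //; last by rewrite (subvP (addvSl _ _)) // (subvP sUD).
by rewrite (subvP sU0B) // memv_cap nuv memvB // (subvP hU).
Qed.

(** Choose [b] in [B] not killing [V], with kernel [K] in [V]. The null component of [b] in [V] is
    [K], so $V=[V,b]+K$; since [B] is abelian, [K] is stable under [B] and induction applies to
    it. *)
Lemma fitting_abelian V B : abelian br V -> abelian br B ->
  {in V & B, forall v b, br v b \in V /\ br b v \in V} ->
  (V <= brv br V B + (V :&: centv B))%VS /\
  (forall z, z \in brv br V B -> z \in centv B -> z = 0).
Proof.
move: {2}(\dim V).+1 (ltnSn (\dim V)) => m; elim: m V => // m IHm V lt_m cV cB hV.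
have kerV b k v : b \in B -> v \in V -> v \in gnull (Rmul b) k ->
    br v b = 0 /\ br b v = 0.
  move=> Bb; apply: gnull_sub_ker => //; first exact: cB.
  by move=> w Vw; apply: hV.
have [VB0 | VBn0] := eqVneq (brv br V B) 0%VS.
  split=> [|z]; last by rewrite VB0 memv0 => /eqP.
  rewrite VB0 add0v subv_cap subvv; apply/subvP => v Vv; apply/centvP => b Bb.
  apply: (kerV b 1%N) => //; rewrite memv_gnullS memv_gnull0 RmulE.
  by rewrite -memv0 -VB0 memv_br.
have [b [Bb nb]] : exists b, b \in B /\ ~~ (V <= lker (Rmul b))%VS.
  apply: NNPP => /not_ex_all_not nex; case/negP: VBn0.
  rewrite -subv0; apply/brvP => v b Vv Bb; rewrite memv0 -RmulE -memv_ker.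
  by have /not_and_or[//|/negP/negbNE/subvP ->] := nex b.
set K := (V :&: lker (Rmul b))%VS; have sKV: (K <= V)%VS by apply: capvSl.
have KP v : (v \in K) = (v \in V) && (br v b == 0).
  by rewrite memv_cap memv_ker RmulE.
have [||||fitK disjK] := IHm K.
- apply: leq_trans (_ : (\dim K).+1 <= \dim V)%N lt_m.
  rewrite ltn_neqAle dimvS // andbT; apply: contraNneq nb => eqd.
  have /eqP <- : K == V by rewrite eqEdim sKV eqd /=.
  exact: capvSr.
- exact: abelianS sKV cV.
- exact: cB.
- move=> v x; rewrite !KP => /andP[Vv /eqP vb] Bx; have [-> ->] := hV v x Vv Bx.
  rewrite br_derivation vb (cB x b) // linear0l linear0r addr0 eqxx.
  by rewrite br_derivation vb (cB x b) // linear0l linear0r addr0 eqxx.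
have Vb : (Rmul b @: V <= V)%VS.
  by apply/subvP => _ /memv_imgP[v Vv ->]; rewrite RmulE; case: (hV v b).
have fitV u : u \in V -> exists2 v, v \in V & u - Rmul b v \in K.
  have [k fit] := fitting_ex _ _ Vb; move=> Vu; have [v Vv nv] := fit u Vu.
  have Vbv : Rmul b v \in V by apply: (subvP Vb); apply: memv_img.
  have Vbbv : Rmul b (Rmul b v) \in V by apply: (subvP Vb); apply: memv_img.
  exists (Rmul b v) => //; have Vd := memvB Vu Vbbv.
  by rewrite KP Vd; have [-> _] := kerV b k _ Bb Vd nv; rewrite eqxx.
split.
  apply/subvP => u Vu; have [v Vv Kuv] := fitV u Vu; rewrite -(subrK (Rmul b v) u).
  rewrite memvD //; last by rewrite (subvP (addvSl _ _)) // RmulE memv_br.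
  apply: (subvP _ _ (subvP fitK _ Kuv)).
  by apply: addvS; [apply: brvS | apply: capvS].
(* Write $z=c+[w,b]$ with [c] in $[K,B]$. As [b] kills [z] and [c], $[[w,b],b]=0$, so $[w,b]=0$ by
   [kerV]; then $z=c$ and induction concludes. *)
move=> z VBz cz.
have sVB : (brv br V B <= brv br K B + Rmul b @: V)%VS.
  apply/brvP => v x Vv Bx; have [w Vw Kvw] := fitV v Vv.
  rewrite -(subrK (Rmul b w) v) linearDl /= memv_add ?memv_br // RmulE.
  rewrite br_derivation (cB _ _ Bb Bx) linear0r addr0 -RmulE memv_img //.
  by case: (hV w x).
have /memv_addP[c KBc [_ /memv_imgP[w Vw ->] Dz]] := subvP sVB z VBz.
have Kc : c \in K.
  apply: (subvP _ _ KBc); apply/brvP => v x; rewrite !KP => /andP[Vv /eqP vb] Bx.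
  have [-> _] := hV v x Vv Bx.
  by rewrite br_derivation vb (cB x b) // linear0l linear0r addr0 eqxx.
have bw0 : br w b = 0.
  suff nw : w \in gnull (Rmul b) 2 by case: (kerV b 2%N w Bb Vw nw).
  rewrite !memv_gnullS memv_gnull0 -[Rmul b w](addKr c) -Dz addrC linearB /= !RmulE.
  have [-> _] := (centvP _ _).1 cz b Bb.
  by move: Kc; rewrite KP => /andP[_ /eqP->]; rewrite subrr.
by apply: disjK => //; rewrite Dz RmulE bw0 addr0.
Qed.

Lemma metabelian_splitting E : subalgebra br E -> abelian br (brv br E E) ->
  exists B, [/\ (B <= E)%VS, abelian br B, (E <= brv br E E + B)%VS,
    (brv br E E <= brv br (brv br E E) B)%VS &
    forall z, z \in brv br E E -> z \in centv B -> z = 0].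
Proof.
set D := brv br E E => hE cD; have /subalgebraP mE := hE.
have [B [sBE cB sEDB]] := abelian_supplement D E cD hE (subvv _).
have DB : {in D & B, forall v b, br v b \in D /\ br b v \in D}.
  move=> v b /(subvP hE) Ev /(subvP sBE) Eb.
  by rewrite !memv_br.
have [fitD disjD] := fitting_abelian D B cD cB DB.
(* $[B,D]$ also falls in $[D,B]$: the centralised part of [d] contributes nothing, and
   $[b,[e,x]]=[[b,e],x]$ because [B] is abelian. *)
have BDB b d : b \in B -> d \in D -> br b d \in brv br D B.
  move=> Bb /(subvP fitD)/memv_addP[y DBy [c]].
  rewrite memv_cap => /andP[Dc /centvP cc] ->.
  rewrite linearDr /= (cc b Bb).2 addr0 -LmulE memv_preim.
  apply: (subvP _ _ DBy); apply/brvP => e x De Bx.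
  rewrite -memv_preim LmulE leibniz (cB _ _ Bb Bx) linear0l subr0 memv_br //.
  by case: (DB e b).
have sDDB : (D <= brv br D B)%VS.
  apply/brvP => _ _ /(subvP sEDB)/memv_addP[d Dd [b Bb ->]]
                    /(subvP sEDB)/memv_addP[e De [c Bc ->]].
  rewrite linearDl !linearDr /= (cD _ _ Dd De) (cB _ _ Bb Bc) add0r addr0.
  by apply: memvD; [apply: memv_br | apply: BDB].
by exists B; split=> // z Dz; apply: disjD; apply: (subvP sDDB).
Qed.

Lemma metabelian_centre E z : subalgebra br E -> abelian br (brv br E E) ->
  z \in brv br E E -> z \in centv E -> z = 0.
Proof.
move=> hE cE; have [B [sBE _ _ _ disj]] := metabelian_splitting E hE cE.
move=> Dz /centvP cz; apply: disj => //; apply/centvP => b Bb.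
by apply: cz; apply: (subvP sBE).
Qed.

(** * Minimal ideals and maximal subalgebras *)

Lemma minimal_ideal_sub I : ideal br I -> I <> 0%VS ->
  exists V, minimal_ideal br V /\ (V <= I)%VS.
Proof.
move: {2}(\dim I).+1 (ltnSn (\dim I)) => m; elim: m I => // m IHm I lt_m hI I0.
case: (classic (exists J, [/\ ideal br J, (J <= I)%VS, J <> 0%VS & J <> I])).
  move=> [J [hJ sJI J0 JI]]; have [|V [minV sVJ]] := IHm J _ hJ J0.
    apply: leq_trans (_ : (\dim J).+1 <= \dim I)%N lt_m.
    rewrite ltn_neqAle dimvS // andbT; apply/eqP => eqd; apply: JI.
    by apply/eqP; rewrite eqEdim sJI eqd /=.
  by exists V; split=> //; apply: subv_trans sJI.
move=> nJ; exists I; split=> //; split=> // J hJ sJI.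
by apply: NNPP => /not_or_and[J0 JI]; apply: nJ; exists J.
Qed.

Lemma monolith_sub W I :
  monolithic_with br W -> ideal br I -> I <> 0%VS -> (W <= I)%VS.
Proof.
move=> [_ uniqW] hI I0; have [V [minV sVI]] := minimal_ideal_sub I hI I0.
by rewrite -(uniqW V minV).
Qed.

Lemma maximal_subalgebra_above U : subalgebra br U -> U <> fullv ->
  exists P, maximal_subalgebra br P /\ (U <= P)%VS.
Proof.
move: {2}(\dim {:L} - \dim U).+1 (ltnSn (\dim {:L} - \dim U)) => m.
elim: m U => // m IHm U lt_m hU Uf.
case: (classic (exists V, [/\ subalgebra br V, (U <= V)%VS, V <> U & V <> fullv])).
  move=> [V [hV sUV VU Vf]]; have [|P [maxP sVP]] := IHm V _ hV Vf.
    have lt_dim : (\dim U < \dim V)%N.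
      rewrite ltn_neqAle dimvS // andbT; apply/eqP => eqd; apply: VU.
      by apply/eqP; rewrite eq_sym eqEdim sUV eqd /=.
    have le_dim : (\dim V <= \dim {:L})%N by apply/dimvS/subvf.
    by rewrite -ltnS (leq_trans _ lt_m) // ltnS ltn_sub2l // (leq_trans lt_dim).
  by exists P; split=> //; apply: subv_trans sVP.
move=> nV; exists U; split=> //; split=> // V hV sUV.
by apply: NNPP => /not_or_and[VU Vf]; apply: nV; exists V.
Qed.

End LeibnizAlgebra.

(** * The monolith, its centraliser and the nilradical *)

Section Monolithic.

Context {F : fieldType} {L : vectType F} {br : {bilinear L -> L -> L}} {n : nat}.
Context {W N : {vspace L}}.
Hypothesis leibniz : right_leibniz br.
Hypothesis A_alg : A_algebra br.
Hypothesis solv : solvable_of_derived_length br n.+1.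
Hypothesis mono : monolithic_with br W.
Hypothesis nilr : is_nilradical br N.

Let K := derived br fullv n.

Lemma ideal_K : ideal br K.
Proof. exact/ideal_derived/idealT. Qed.

Lemma abelian_K : abelian br K.
Proof. by apply/abelian_brv0; case: solv. Qed.

Lemma monolith_sub_K : (W <= K)%VS.
Proof. by apply: monolith_sub mono ideal_K _; case: solv. Qed.

Lemma monolith_abelian : abelian br W.
Proof. exact: abelianS monolith_sub_K abelian_K. Qed.

Lemma monolith_neq0 : W <> 0%VS.
Proof. by case: mono => [[]]. Qed.

Lemma abelian_nilradical : abelian br N.
Proof. by case: nilr => hN nN _; apply: A_alg => //; apply: ideal_subalgebra. Qed.

Lemma abelian_ideal_sub_nilradical I : ideal br I -> abelian br I -> (I <= N)%VS.
Proof. by case: nilr => _ _ maxN hI cI; apply: maxN => //; apply: abelian_nilpotent. Qed.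

Lemma K_sub_nilradical : (K <= N)%VS.
Proof. exact: abelian_ideal_sub_nilradical ideal_K abelian_K. Qed.

Lemma nilradical_sub_centralizer : (N <= centv (br := br) W)%VS.
Proof.
apply/subvP => x Nx; apply/centvP => w Ww.
have Nw : w \in N by apply: (subvP K_sub_nilradical); apply: (subvP monolith_sub_K).
by rewrite !abelian_nilradical.
Qed.

(* Otherwise the last nonzero term [E, E] of the derived series of C(W)
   contains W, which is central in E. *)
Lemma centralizer_sub_nilradical : (centv (br := br) W <= N)%VS.
Proof.
set C := centv W; have hC : ideal br C by apply: ideal_centv => //; case: mono => [[]].
have sol : derived br C n.+1 = 0%VS.
  apply/eqP; rewrite -subv0 -(proj1 solv).
  by elim: n.+1 => [|k IHk]; [apply: subvf | apply: brvS].
have exk : exists k, derived br C k == 0%VS by exists n.+1; apply/eqP.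
(* The least vanishing index is 0 ([C] is zero), 1 ([C] is abelian) or [k.+2], the case to
   refute. *)
have := @ex_minnP _ exk; case=> [[|[|k]]].
- by move=> /eqP /= C0 _; rewrite C0 sub0v.
- by move=> /eqP/abelian_brv0 cC _; apply: abelian_ideal_sub_nilradical.
move=> /eqP cD min_k; set E := derived br C k.
have hE : ideal br E by apply: ideal_derived.
have D0 : brv br E E <> 0%VS.
  by move=> /eqP; rewrite -derivedS => /min_k; rewrite ltnn.
case: monolith_neq0; apply/eqP; rewrite -subv0; apply/subvP => w Ww; rewrite memv0.
apply/eqP; apply: (metabelian_centre leibniz A_alg E).
- exact: ideal_subalgebra.
- exact/abelian_brv0.
- have hD : ideal br (brv br E E) by apply: ideal_brv.
  exact: (subvP (monolith_sub _ _ mono hD D0)).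
apply/centvP => x Ex; have /centvP/(_ w Ww)[xw wx] // : x \in C.
have sEC : (E <= C)%VS; last exact: (subvP sEC).
rewrite /E; elim: k {cD min_k E hE D0 Ex} => [|k IHk] /=; first exact: subvv.
exact: subv_trans (brvS _ _ _ _ IHk IHk) (ideal_subalgebra _ hC).
Qed.

Lemma nilradicalP x : x \in N <-> centraliser br W x.
Proof.
split=> [Nx | /centvP cx]; first exact/centvP/(subvP nilradical_sub_centralizer).
exact: (subvP centralizer_sub_nilradical).
Qed.

(** For [n = 0] the truncated predecessor gives [M = K], so facts about the step from [M] to [K]
    assume [0 < n]. *)
Let M := derived br fullv n.-1.

Lemma ideal_M : ideal br M.
Proof. exact/ideal_derived/idealT. Qed.

Lemma brv_MM : (0 < n)%N -> brv br M M = K.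
Proof. by move=> n_gt0; rewrite -derivedS prednK. Qed.

Lemma centv_M : (0 < n)%N -> centv (br := br) M = 0%VS.
Proof.
move=> n_gt0; apply: NNPP => cM0; have KE := brv_MM n_gt0.
have sWc := monolith_sub _ _ mono (ideal_centv leibniz _ ideal_M) cM0.
case: monolith_neq0; apply/eqP; rewrite -subv0; apply/subvP => w Ww; rewrite memv0.
apply/eqP; apply: (metabelian_centre leibniz A_alg M).
- exact/ideal_subalgebra/ideal_M.
- by rewrite KE; apply: abelian_K.
- by rewrite KE (subvP monolith_sub_K).
exact: (subvP sWc).
Qed.

Lemma centreP : (0 < n)%N -> forall z, centre br z <-> z = 0.
Proof.
move=> n_gt0 z; split=> [cz | -> x]; last by rewrite linear0l linear0r.
by apply/eqP; rewrite -memv0 -(centv_M n_gt0); apply/centvP => x _; apply: cz.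
Qed.

(** $[L,W]$ is an ideal inside [W], so it is [W] or 0. If it is 0, then $[W,L]$ becomes an ideal
    too, and it is nonzero because the centre is zero. *)
Lemma monolith_br : (0 < n)%N -> brv br fullv W = W \/ brv br W fullv = W.
Proof.
move=> n_gt0; have [[/[dup] hW [WL LW] W0 minW] _] := mono.
have [LW0 | /eqP nLW] := eqVneq (brv br fullv W) 0%VS; last first.
  left; have [|//|//] := minW (brv br fullv W) _ LW.
  split; apply/brvP => y x; last first.
    by move=> _ /(subvP LW); apply: memv_br; rewrite memvf.
  move=> + _; rewrite -RmulE memv_preim; move: y; apply/subvP/brvP => y w _ Ww.
  rewrite -memv_preim RmulE br_derivation // memvD ?memv_br ?memvf //.
  by apply: (subvP WL); rewrite memv_br ?memvf.
have [WL0 | /eqP nWL] := eqVneq (brv br W fullv) 0%VS.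
  case: W0; apply/eqP; rewrite -subv0; apply/subvP => w Ww; rewrite memv0.
  apply/eqP/(centreP n_gt0) => x; split; apply/eqP; rewrite -memv0.
    by rewrite -WL0 memv_br ?memvf.
  by rewrite -LW0 memv_br ?memvf.
right; have [|//|//] := minW (brv br W fullv) _ WL.
split; apply/brvP => y x; first by move=> /(subvP WL) Wy _; rewrite memv_br ?memvf.
move=> _ /(subvP WL) Wx; have: br y x \in 0%VS by rewrite -LW0 memv_br ?memvf.
by rewrite memv0 => /eqP->; apply: mem0v.
Qed.

Lemma nilradicalE : N = K.
Proof.
apply/eqP; rewrite eqEsubv K_sub_nilradical andbT.
have [n0 | n_gt0] := posnP n; first by rewrite /K n0 subvf.
have KE := brv_MM n_gt0; have cM0 := centv_M n_gt0.
have cN := abelian_nilradical.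
have [hN _ _] := nilr; have /(idealP _) mN := hN; have /(idealP _) mM := ideal_M.
have hM : subalgebra br M by apply/ideal_subalgebra/ideal_M.
have cMM : abelian br (brv br M M) by rewrite KE; apply: abelian_K.
have [B [sBM cB sMKB _ _]] := metabelian_splitting leibniz A_alg M hM cMM.
have NB : {in N & B, forall v b, br v b \in N /\ br b v \in N}.
  by move=> v b Nv _; apply: mN.
have [fitN _] := fitting_abelian leibniz A_alg N B cN cB NB.
(* An element of [N] centralising [B] centralises [K] as well, since [N] is abelian and contains
   [K]; hence it centralises $M=K+B$. *)
have cNB : (N :&: centv (br := br) B)%VS = 0%VS.
  apply/eqP; rewrite -subv0; apply/subvP => x; rewrite memv_cap => /andP[Nx /centvP cx].
  rewrite -cM0; apply/centvP => y /(subvP sMKB)/memv_addP[k]; rewrite KE.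
  move=> /(subvP K_sub_nilradical) Nk [b /cx[xb bx] ->].
  by rewrite linearDl linearDr /= xb bx !cN // !addr0.
have sNNB : (N <= brv br N B)%VS by move: fitN; rewrite cNB addv0.
have sNM : (N <= M)%VS.
  apply: subv_trans sNNB _; apply/brvP => x b _ /(subvP sBM) Mb.
  by case: (mM b x Mb).
by rewrite -KE (subv_trans sNNB) // brvS.
Qed.

(** * The Frattini ideal *)

Lemma proper_supplement_K : exists U, [/\ subalgebra br U, U <> fullv & (U + K)%VS = fullv].
Proof.
have [n0 | n_gt0] := posnP n.
  exists 0%VS; split; first exact/ideal_subalgebra/ideal0.
    by move=> L0; case: monolith_neq0; apply/eqP; rewrite -subv0 L0 subvf.
  by rewrite add0v /K n0.
have KE := brv_MM n_gt0; have /(idealP _) mK := ideal_K; have /(idealP _) mM := ideal_M.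
have hM : subalgebra br M by apply/ideal_subalgebra/ideal_M.
have cMM : abelian br (brv br M M) by rewrite KE; apply: abelian_K.
have [B [sBM cB _]] := metabelian_splitting leibniz A_alg M hM cMM.
rewrite KE => sKKB _.
(* Such a [b] exists because [K] is nonzero and contained in $[K,B]$. *)
have [b [Bb nb]] : exists b, b \in B /\ ~ (K <= lker (Rmul (br := br) b))%VS.
  apply: NNPP => /not_ex_all_not nex; case: solv => _; case.
  apply/eqP; rewrite -subv0; apply: subv_trans sKKB _.
  apply/brvP => k b Kk Bb; rewrite memv0 -RmulE -memv_ker.
  by have /not_and_or[//|/NNPP/subvP->] := nex b.
have hL : subalgebra br fullv by apply: subvf.
have [k [stab fit]] := fitting_null _ _ (Rmul_stable fullv b hL (memvf b)).
have hU := fitting_null_subalgebra leibniz fullv b k hL stab.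
exists (fullv :&: gnull (Rmul (br := br) b) k)%VS; split=> //.
  (* If the null component were all of [L], [gnull_sub_ker] would make [b] kill [K]. *)
  rewrite capfv => Uf; apply: nb; apply/subvP => v Kv.
  have nv : v \in gnull (Rmul (br := br) b) k by rewrite Uf memvf.
  have [vb _] := gnull_sub_ker leibniz A_alg abelian_K (cB _ _ Bb Bb)
    (fun u Ku => mK u b Ku) Kv nv.
  by rewrite memv_ker RmulE vb.
(* The remaining Fitting part consists of elements $[[v,b],b]$, which lie in $[M,M]=K$ because [M]
   is an ideal containing [b]. *)
apply/eqP; rewrite eqEsubv subvf; apply/subvP => u _; have [v _ nv] := fit u (memvf u).
rewrite -(subrK (Rmul (br := br) b (Rmul (br := br) b v)) u).
rewrite capfv memv_add //; have Mb := subvP sBM b Bb.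
by rewrite !RmulE -KE memv_br //; case: (mM b v Mb).
Qed.

Lemma phi_free_monolith : phi_free br -> W = N.
Proof.
move=> [_ _ maxP]; have [[hW W0 _] _] := mono.
have [P [maxlP nWP]] : exists P, maximal_subalgebra br P /\ ~ (W <= P)%VS.
  apply: NNPP => nex; case: W0; apply/eqP; rewrite -subv0; apply: maxP => // P maxlP.
  by apply: NNPP => nWP; apply: nex; exists P.
have [/(subalgebraP _) mP Pf max] := maxlP; have /(idealP _) mW := hW.
have WPf : (W + P)%VS = fullv.
  case: (max (W + P)%VS) => // [|| WPP]; [|exact: addvSr|].
    apply/subalgebraP => _ _ /memv_addP[w Ww [p Pp ->]] /memv_addP[v Wv [q Pq ->]].
    have -> : br (w + p) (v + q) = br w (v + q) + br p v + br p q.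
      by rewrite linearDl !linearDr /= !addrA.
    rewrite memv_add ?mP // memvD //; first by case: (mW w (v + q)).
    by case: (mW v p).
  by case: nWP; rewrite -WPP addvSl.
have /(idealP _) mK := ideal_K.
(* [W] lies in the abelian ideal [K], so in $L=W+P$ only the [P]-component of [x] acts on
   [K :&: P]. *)
have hQ : ideal br (K :&: P)%VS.
  apply/idealP => k x; rewrite memv_cap => /andP[Kk Pk].
  have /memv_addP[w Ww [p Pp ->]] : x \in (W + P)%VS by rewrite WPf memvf.
  have Kw := subvP monolith_sub_K w Ww; have [Kkp Kpk] := mK k p Kk.
  rewrite linearDl linearDr /= (abelian_K _ _ Kk Kw) (abelian_K _ _ Kw Kk) !add0r.
  by rewrite !memv_cap Kkp Kpk !mP.
have Q0 : (K :&: P)%VS = 0%VS.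
  apply: NNPP => /(monolith_sub _ _ mono hQ) sWQ; apply: nWP.
  exact: subv_trans sWQ (capvSr _ _).
rewrite nilradicalE; apply/eqP; rewrite eqEsubv monolith_sub_K /=.
apply/subvP => k Kk; have : k \in (W + P)%VS by rewrite WPf memvf.
move=> /memv_addP[w Ww [p Pp Dk]]; have : p \in (K :&: P)%VS.
  rewrite memv_cap Pp andbT -[p](addKr w) -Dk addrC memvB //.
  exact: (subvP monolith_sub_K).
by rewrite Q0 memv0 Dk => /eqP->; rewrite addr0.
Qed.

(** A nonzero ideal inside every maximal subalgebra contains $W=K$; a maximal subalgebra above the
    proper supplement of [K] would then be all of [L]. *)
Lemma monolith_phi_free : W = N -> phi_free br.
Proof.
rewrite nilradicalE => WK; split; [exact: ideal0 | by move=> P _; apply: sub0v |].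
move=> I hI allI; rewrite subv0; apply/eqP; apply: NNPP => I0.
have [U [hU Uf UKf]] := proper_supplement_K.
have [P [maxlP sUP]] := maximal_subalgebra_above U hU Uf.
have [_ Pf _] := maxlP; apply: Pf; apply/eqP; rewrite eqEsubv subvf -UKf subv_add sUP /= -WK.
exact: subv_trans (monolith_sub _ _ mono hI I0) (allI P maxlP).
Qed.

End Monolithic.

Theorem theorem5p1 (F : fieldType) (L : vectType F)
    (br : {bilinear L -> L -> L}) (n : nat) (W N : {vspace L})
    (A : 'I_n.+1 -> {vspace L}) :
  right_leibniz br ->
  A_algebra br ->
  solvable_of_derived_length br n.+1 ->
  monolithic_with br W ->
  is_nilradical br N ->
  directv (\sum_(i < n.+1) A i)%VS ->
  (\sum_(i < n.+1) A i)%VS = fullv ->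
  (forall i : 'I_n.+1, subalgebra br (A i) /\ abelian br (A i)) ->
  (forall i : 'I_n.+1,
     derived br fullv i = (\sum_(j < n.+1 | (i <= j)%N) A j)%VS) ->
  abelian br W
  /\ (* the one-dimensional algebra, n = 0, is its own centre *)
     ((0 < n)%N ->
        (forall z, centre br z <-> z = 0) /\
        (brv br fullv W = W \/ brv br W fullv = W))
  /\ (N = A ord_max /\ A ord_max = derived br fullv n)
  /\ (forall x, x \in N <-> centraliser br W x)
  /\ (phi_free br <-> W = N).
Proof.
move=> leibniz A_alg solv mono nilr _ _ _ derA.
(* The only index $j\le n$ with $n\le j$ is $n$, so the sum giving $L^{(n)}$ has a single term. *)
have An : A ord_max = derived br fullv n.
  rewrite (derA ord_max) (big_pred1 ord_max) // => j.
  by rewrite /= -val_eqE /= eqn_leq leq_ord.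
split; first exact: (monolith_abelian leibniz solv mono).
split.
  move=> n_gt0; split; first exact: (centreP leibniz A_alg solv mono n_gt0).
  exact: (monolith_br leibniz A_alg solv mono n_gt0).
split; first by rewrite An (nilradicalE leibniz A_alg solv mono nilr).
split; first exact: (nilradicalP leibniz A_alg solv mono nilr).
split; first exact: (phi_free_monolith leibniz A_alg solv mono nilr).
exact: (monolith_phi_free leibniz A_alg solv mono nilr).
Qed.
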